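(* Let $A,B$ be polynomials of the same degree $n$ and $C,D$ be rational functions such that $$A\circ C=B\circ D.$$ Then there exist a rational function $W$, mutually distinct points of the complex sphere $\gamma_i$, $1\le i\le r$, and complex numbers $\alpha_i,\beta_i$, $0\le i\le r$, such that $$C=\left(\alpha_0+\frac{\alpha_1}{z-\gamma_1}+\dots+\frac{\alpha_r}{z-\gamma_r}\right)\circ W,\qquad D=\left(\beta_0+\frac{\beta_1}{z-\gamma_1}+\dots+\frac{\beta_r}{z-\gamma_r}\right)\circ W.$$ Furthermore, if $\alpha$ is the leading coefficient of $A$ and $\beta$ is the leading coefficient of $B$, then $\alpha\alpha_i^n=\beta\beta_i^n$, $1\le i\le r$.
   Context: Polynomials and rational functions have complex coefficients and are nonconstant. Convention: if $\gamma_i=\infty$ for some $i$, the corresponding terms $\frac{\alpha_i}{z-\gamma_i}$, $\frac{\beta_i}{z-\gamma_i}$ are to be read as $\alpha_i z$, $\beta_i z$. *)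

(* Defs.v *)
From HB Require Import structures.
From mathcomp Require Import all_boot all_order all_algebra.
From mathcomp Require Import reals complex.

Set Implicit Arguments.
Unset Strict Implicit.
Unset Printing Implicit Defensive.

Import Order.TTheory GRing.Theory Num.Theory.
Local Open Scope ring_scope.
Local Open Scope quotient_scope.

Notation ratfun K := {fraction {poly K}}.
Notation "p %:F" := (FracField.tofrac p) : ring_scope.

Section RationalFunctions.
Variable K : fieldType.
Implicit Types (p q : {poly K}) (F W : ratfun K).

Definition rconst (c : K) : ratfun K := c%:P%:F.

Definition nonconstant F : Prop := forall c : K, F <> rconst c.

Definition psubst p W : ratfun K := (map_poly rconst p).[W].

(* F o W: W is substituted into a representative fraction of F. For
   nonconstant W the result does not depend on the representative (see
   [rcompE]); for constant W it may be a junk value, 0, when the denominator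
   vanishes. *)
Definition rcomp F W : ratfun K :=
  psubst \n_(repr F) W / psubst \d_(repr F) W.

(* A point of the sphere is an [option K], with [None] standing for infinity:
   the term is a / (z - g) for finite g, and a * z for g = infinity. *)
Definition pole_term (a : K) (g : option K) : ratfun K :=
  if g is Some c then a%:P%:F / ('X - c%:P)%:F else (a *: 'X)%:F.

Definition simple_pole_fun (r : nat) (g : 'I_r -> option K)
    (a0 : K) (a : 'I_r -> K) : ratfun K :=
  rconst a0 + \sum_(i < r) pole_term (a i) (g i).

Lemma rconst_is_zmod_morphism : zmod_morphism rconst.
Proof. by move=> a b; rewrite /rconst !rmorphB. Qed.

Lemma rconst_is_monoid_morphism : monoid_morphism rconst.
Proof. by split=> [|a b]; rewrite /rconst ?rmorph1 ?rmorphM. Qed.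

HB.instance Definition _ := GRing.isZmodMorphism.Build K (ratfun K) rconst
  rconst_is_zmod_morphism.
HB.instance Definition _ := GRing.isMonoidMorphism.Build K (ratfun K) rconst
  rconst_is_monoid_morphism.

Lemma ratfun_repr F : F = (\n_(repr F))%:F / (\d_(repr F))%:F.
Proof.
have dF0 : (\d_(repr F))%:F != 0 by rewrite tofrac_eq0 denom_ratioP.
apply: (mulIf dF0); rewrite divfK // -[X in X * _]reprK.
unlock FracField.tofrac; rewrite -[LHS]FracField.pi_mul; apply/eqmodP => /=.
by rewrite FracField.equivfE !numden_Ratio ?mulf_neq0 ?denom_ratioP
  ?oner_neq0 // !mulr1 mulrC.
Qed.

End RationalFunctions.

Section CompositionWellDefined.
Variable K : closedFieldType.

Lemma psubst_neq0 (q : {poly K}) (W : ratfun K) :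
  nonconstant W -> q != 0 -> psubst q W != 0.
Proof.
move=> ncW q0; have [s ->] := closed_field_poly_normal q.
rewrite /psubst map_polyZ hornerZ mulf_neq0 ?fmorph_eq0 ?lead_coef_eq0 //.
rewrite rmorph_prod horner_prod prodf_seq_neq0; apply/allP => c _ /=.
rewrite rmorphB /= map_polyX map_polyC hornerD hornerN hornerX hornerC.
by rewrite subr_eq0; apply/eqP/ncW.
Qed.

Lemma rcompE (p q : {poly K}) (W : ratfun K) :
  nonconstant W -> q != 0 ->
  rcomp (p%:F / q%:F) W = psubst p W / psubst q W.
Proof.
move=> ncW q0; rewrite /rcomp.
have := ratfun_repr (p%:F / q%:F); set x := repr _ => /eqP.
have d0 : \d_x != 0 := denom_ratioP x.
rewrite eqr_div ?tofrac_eq0 // -!tofracM tofrac_eq => /eqP E.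
apply/eqP; rewrite eqr_div ?psubst_neq0 //.
by rewrite /psubst -!hornerM -!rmorphM E.
Qed.

End CompositionWellDefined.

(* Main.v *)
Require Import Defs.
From HB Require Import structures.
From mathcomp Require Import all_boot all_order all_algebra.
From mathcomp Require Import boolp.
From mathcomp Require Import reals complex.

Set Implicit Arguments.
Unset Strict Implicit.
Unset Printing Implicit Defensive.

Import Order.TTheory GRing.Theory Num.Theory.
Local Open Scope ring_scope.

(** The functions [C] and [D] generate a subfield [L] of the field of rational
    functions in one variable [z]. By Lueroth's theorem ([Luroth]), [L] is
    generated by one function [W]; hence [C = C1 o W] and [D = D1 o W], where
    [A o C1 = B o D1] and [C1], [D1] generate the whole field. It remains to
    see that all the poles of [C1] and [D1], infinity included, are simple:
    [C1] and [D1] are then the sums of their polar parts and of constants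
    ([partial_fractions]), and comparing the leading coefficients of
    [A o C1 = B o D1] at each pole gives the relation between the residues.

    Poles are simple because the plane curve [A(x) = B(y)] is transverse to the
    line at infinity: the two polynomials have the same degree [n]. In detail,
    let [g] be a pole of [C1], and put [X = 1 / C1], [Y = D1 / C1]. The
    homogenized equation shows that [Y] has a finite value [c] at [g], with
    [lead_coef A = lead_coef B * c ^+ n], so that [c] is nonzero, and that
    [(Y - c) G1 = X G2] for polynomials [G1], [G2] in [X] and [Y] such that [G1]
    does not vanish at [g] ([smooth_at_infinity]). If a polynomial [F] in [X]
    and [Y] vanishes at [g], then [F G1] is thus [X] times a polynomial in [X]
    and [Y]; by induction the order of [F] at [g] is a multiple of the order
    [k] of [X] ([gen_order]). As [z] is a quotient of polynomials in [X] and
    [Y], the order 1 of [z - g] is a multiple of [k], and so [k = 1]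
    ([gen_order1], [simple_poles]). Infinity is reduced to the point 0 by the
    substitution of [1 / z].

    For Lueroth's theorem, let [m] be the minimal polynomial of [z] over [L],
    and let [W = p / q], in lowest terms, be a nonconstant coefficient of [m]
    made monic. The primitive form of [m], in two variables, has degree at
    least [max (deg p) (deg q)] in [z], and it divides
    [p(T) q(z) - p(z) q(T)] by Gauss's lemma. The quotient has degree 0 in [z],
    and is then constant, as [p] and [q] are coprime; hence [m] has degree
    [max (deg p) (deg q)] ([minimal_relation_size]). Thus [z] has the same
    degree over [L] as over the subfield of the functions of [W], and the two
    fields are equal. *)

(** * Substitution into rational functions *)

Section Substitution.
Variable K : fieldType.
Implicit Types (p q : {poly K}) (F W : ratfun K).

(** A fraction in lowest terms. *)
Lemma ratfun_frac F :
  exists p q, [/\ q != 0, coprimep p q & F = p%:F / q%:F].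
Proof.
have [q0 eF] : \d_(repr F) != 0 /\ F = (\n_(repr F))%:F / (\d_(repr F))%:F.
  by split; [exact: denom_ratioP | exact: ratfun_repr].
move: (\n_(repr F)) (\d_(repr F)) q0 eF => p q q0 ->.
pose g := gcdp p q.
have g0 : g != 0 by rewrite gcdp_eq0 negb_and q0 orbT.
have ep : p = p %/ g * g by rewrite divpK // dvdp_gcdl.
have eq' : q = q %/ g * g by rewrite divpK // dvdp_gcdr.
have q'0 : q %/ g != 0 by apply: contraNneq q0 => e; rewrite eq' e mul0r.
exists (p %/ g), (q %/ g); split=> //.
  by apply: coprimep_div_gcd; rewrite q0 orbT.
rewrite {1}ep {1}eq' !tofracM -mulf_div divff ?mulr1 //.
by rewrite tofrac_eq0.
Qed.

Lemma psubstC (c : K) W : psubst c%:P W = rconst c.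
Proof. by rewrite /psubst map_polyC hornerC. Qed.

Lemma psubst1 W : psubst 1 W = 1.
Proof. by rewrite /psubst rmorph1 hornerC. Qed.

Lemma psubstX W : psubst 'X W = W.
Proof. by rewrite /psubst map_polyX hornerX. Qed.

Lemma psubstD p q W : psubst (p + q) W = psubst p W + psubst q W.
Proof. by rewrite /psubst rmorphD hornerD. Qed.

Lemma psubstM p q W : psubst (p * q) W = psubst p W * psubst q W.
Proof. by rewrite /psubst rmorphM hornerM. Qed.

Lemma psubstE p W :
  psubst p W = \sum_(i < size p) rconst p`_i * W ^+ i.
Proof.
rewrite /psubst horner_coef size_map_poly.
by apply: eq_bigr => i _; rewrite coef_map.
Qed.

Lemma psubst_id p : psubst p 'X%:F = p%:F.
Proof.
elim/poly_ind: p => [|p c IH]; first by rewrite /psubst rmorph0 horner0 tofrac0.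
by rewrite psubstD psubstM psubstX psubstC IH tofracD tofracM.
Qed.

Lemma nonconstant_neq0 F : nonconstant F -> F != 0.
Proof.
by move=> nF; apply/eqP => F0; apply: (nF 0); rewrite F0 /rconst tofrac0.
Qed.

Lemma nonconstantX : nonconstant ('X%:F : ratfun K).
Proof.
move=> c /eqP; rewrite tofrac_eq => /eqP/(congr1 (fun p : {poly K} => size p)).
by rewrite size_polyX size_polyC; case: (c != 0).
Qed.

Lemma nonconstantV F : nonconstant F -> nonconstant F^-1.
Proof.
move=> nF c e; apply: (nF c^-1).
by rewrite -[LHS]invrK e fmorphV.
Qed.

End Substitution.

Section Composition.
Variable K : closedFieldType.
Implicit Types (p q : {poly K}) (F G W : ratfun K).

Lemma rcomp_poly p W : nonconstant W -> rcomp p%:F W = psubst p W.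
Proof.
move=> ncW; rewrite -[p%:F]divr1 -tofrac1 rcompE ?oner_neq0 //.
by rewrite psubst1 divr1.
Qed.

(** The substitution of a nonconstant function, as a field homomorphism. *)
Definition csubst W (_ : nonconstant W) F : ratfun K := rcomp F W.

Section Morphism.
Variables (W : ratfun K) (ncW : nonconstant W).

Lemma csubst_is_zmod_morphism : zmod_morphism (csubst ncW).
Proof.
move=> F G; rewrite /csubst.
have [p [q [q0 _ ->]]] := ratfun_frac F.
have [p1 [q1 [q10 _ ->]]] := ratfun_frac G.
rewrite -mulNr -tofracN addf_div ?tofrac_eq0 // -!tofracM -tofracD.
rewrite !rcompE ?mulf_neq0 // !(psubstD, psubstM) -addf_div ?psubst_neq0 //.
by congr (_ + _); rewrite /psubst rmorphN hornerN mulNr.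
Qed.

Lemma csubst_is_monoid_morphism : monoid_morphism (csubst ncW).
Proof.
split=> [|F G]; rewrite /csubst.
  by rewrite -tofrac1 rcomp_poly // psubst1.
have [p [q [q0 _ ->]]] := ratfun_frac F.
have [p1 [q1 [q10 _ ->]]] := ratfun_frac G.
rewrite mulf_div -!tofracM !rcompE ?mulf_neq0 // !psubstM.
by rewrite -mulf_div.
Qed.

HB.instance Definition _ := GRing.isZmodMorphism.Build (ratfun K) (ratfun K)
  (csubst ncW) csubst_is_zmod_morphism.
HB.instance Definition _ := GRing.isMonoidMorphism.Build (ratfun K) (ratfun K)
  (csubst ncW) csubst_is_monoid_morphism.

Lemma csubst_const c : csubst ncW (rconst c) = rconst c.
Proof. by rewrite /csubst rcomp_poly // psubstC. Qed.

Lemma csubstX : csubst ncW 'X%:F = W.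
Proof. by rewrite /csubst rcomp_poly // psubstX. Qed.

Lemma csubst_psubst p F : csubst ncW (psubst p F) = psubst p (csubst ncW F).
Proof.
rewrite !psubstE rmorph_sum; apply: eq_bigr => i _.
by rewrite rmorphM rmorphXn /= csubst_const.
Qed.

Lemma csubst_inj : injective (csubst ncW).
Proof. exact: fmorph_inj. Qed.

End Morphism.
End Composition.

(** * Lueroth's theorem *)

Lemma exists_min (P : nat -> Prop) :
  (exists n, P n) -> exists n, P n /\ forall m, P m -> (n <= m)%N.
Proof.
move=> [n Pn]; have exP : exists n, `[< P n >] by exists n; apply/asboolP.
case: (ex_minnP exP) => m /asboolP Pm min_m.
by exists m; split=> // k Pk; apply/min_m/asboolP.
Qed.

Lemma clear_denominators (K : fieldType) (m : {poly ratfun K}) :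
  exists (c : {poly K}) M, c != 0 /\
    c%:F *: m = map_poly (@FracField.tofrac {poly K}) M.
Proof.
elim/poly_ind: m => [|m x [c [M [c0 eM]]]].
  by exists 1, 0; rewrite oner_neq0 scaler0 rmorph0.
have [b [d [d0 _ ->]]] := ratfun_frac x.
exists (c * d), (d%:P * M * 'X + (c * b)%:P); split; first exact: mulf_neq0.
rewrite rmorphD /= [map_poly _ (_ * 'X)]rmorphM /= map_polyX map_polyC /=.
rewrite [map_poly _ (_ * _)]rmorphM /= map_polyC /= -eM.
rewrite !tofracM scalerDr; congr (_ + _).
  by rewrite mul_polyC scalerA scalerAl [d%:F * _]mulrC.
by rewrite scale_polyC -mulrA [d%:F * _]mulrC divfK ?tofrac_eq0.
Qed.

Section Primitive.
Variable K : closedFieldType.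
Implicit Types (c : {poly K}) (N P Q : {poly {poly K}}).

(** Content and primitive part. The outer variable is [z]: over an algebraically
    closed field, a polynomial in [z] whose coefficients are polynomials in [T]
    has no nonconstant factor in [z] alone if and only if it does not vanish
    when [z] is given a value. *)
Lemma primitive_part N : N != 0 -> exists c N0,
  [/\ c != 0, N = c^:P * N0 & forall t : K, N0.[t%:P] != 0].
Proof.
have [n] := ubnP (size N); elim: n N => // n IH N leN N0.
have [[t rt]|nr] := pselect (exists t : K, root N t%:P); last first.
  exists 1, N; rewrite oner_neq0 rmorph1 mul1r; split=> // t.
  by apply: contra_notN nr => rt; exists t.
have [Q eN] := factor_theorem _ _ rt.
have Q0 : Q != 0 by apply: contraNneq N0 => Q0; rewrite eN Q0 mul0r.
have sN : size N = (size Q).+1.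
  by rewrite eN size_Mmonic ?monicXsubC // size_XsubC addn2.
have [|c [N1 [c0 eQ prim]]] := IH Q _ Q0; first by rewrite -ltnS -sN.
exists (c * ('X - t%:P)), N1; split=> //.
  by rewrite mulf_neq0 ?polyXsubC_eq0.
by rewrite eN eQ rmorphM rmorphB /= map_polyX map_polyC /= mulrAC.
Qed.

(** Gauss's lemma. *)
Lemma primitive_dvd N0 Q P c : c != 0 -> (forall t : K, N0.[t%:P] != 0) ->
  N0 * Q = c^:P * P -> exists Q', N0 * Q' = P.
Proof.
move=> c0 prim; have [n] := ubnP (size c).
elim: n c Q c0 => // n IH c Q c0 lec eq.
have [/closed_rootP [t rt]|] := boolP (size c != 1); last first.
  rewrite negbK => /size_poly1P [a a0 ec].
  exists (a^-1%:P%:P * Q); rewrite mulrCA eq ec map_polyC /= mulrA.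
  by rewrite -!rmorphM mulVf // !rmorph1 mul1r.
have [c' ec] := factor_theorem _ _ rt.
have c'0 : c' != 0 by apply: contraNneq c0 => c'0; rewrite ec c'0 mul0r.
have sc : size c = (size c').+1.
  by rewrite ec size_Mmonic ?monicXsubC // size_XsubC addn2.
have rQ : root Q t%:P.
  have := congr1 (fun p => p.[t%:P]) eq; rewrite !hornerM.
  rewrite horner_map /= (rootP rt) mul0r => /eqP.
  by rewrite mulf_eq0 (negPf (prim t)).
have [Q' eQ] := factor_theorem _ _ rQ.
apply: (IH c' Q') => //; first by rewrite -ltnS -sc.
have X0 : 'X - t%:P%:P != 0 :> {poly {poly K}} by rewrite polyXsubC_eq0.
apply: (mulIf X0); rewrite -mulrA -eQ eq ec rmorphM rmorphB /= map_polyX.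
by rewrite map_polyC /= mulrAC.
Qed.

End Primitive.

(** A subfield of the field of rational functions, containing the constants. It
    is a [Prop]-valued predicate, as membership need not be decidable. *)
Record is_subfield (K : fieldType) (L : ratfun K -> Prop) : Prop := {
  subfield_const : forall c, L (rconst c);
  subfieldD : forall F G, L F -> L G -> L (F + G);
  subfieldM : forall F G, L F -> L G -> L (F * G);
  subfieldV : forall F, L F -> L F^-1 }.

Section Subfield.
Variables (K : fieldType) (L : ratfun K -> Prop).
Hypothesis subL : is_subfield L.

Lemma subfield0 : L 0.
Proof. by have := subfield_const subL 0; rewrite rmorph0. Qed.

Lemma subfieldN F : L F -> L (- F).
Proof.
move=> LF; rewrite -mulN1r -[-1](rmorphN1 (@rconst K)).
by apply: subfieldM => //; exact: subfield_const.
Qed.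

Lemma subfieldB F G : L F -> L G -> L (F - G).
Proof. by move=> LF LG; apply: subfieldD => //; exact: subfieldN. Qed.

Lemma subfield_psubst p F : L F -> L (psubst p F).
Proof.
move=> LF; elim/poly_ind: p => [|p c IH].
  by rewrite /psubst rmorph0 horner0; exact: subfield0.
rewrite psubstD psubstM psubstX psubstC.
by apply: subfieldD => //; [exact: subfieldM | exact: subfield_const].
Qed.

Local Notation z := ('X%:F : ratfun K).

(** The polynomial [m] generates the ideal of the polynomials over [L] that
    vanish at the variable [z]. *)
Definition minimal_relation (m : {poly ratfun K}) : Prop :=
  [/\ m != 0, forall i, L m`_i, m.[z] = 0
    & forall h : {poly ratfun K}, (forall i, L h`_i) -> h.[z] = 0 -> m %| h].

Lemma exists_minimal_relation C : L C -> nonconstant C ->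
  exists m, minimal_relation m.
Proof.
move=> LC ncC.
have [n [[m [sm m0 Lm mz]] min_n]] : exists n,
    (exists m : {poly ratfun K},
       [/\ size m = n, m != 0, forall i, L m`_i & m.[z] = 0]) /\
    forall k, (exists m : {poly ratfun K},
       [/\ size m = k, m != 0, forall i, L m`_i & m.[z] = 0]) -> (n <= k)%N.
  apply: exists_min; have [p [q [q0 _ eC]]] := ratfun_frac C.
  pose h := map_poly (@rconst K) p - C *: map_poly (@rconst K) q.
  exists (size h), h; split=> //.
  - apply/eqP => /(congr1 (fun h : {poly ratfun K} => h`_(size q).-1)).
    rewrite coef0 coefB coefZ !coef_map /= => /eqP; rewrite subr_eq0 => /eqP e.
    apply: (ncC (p`_(size q).-1 / lead_coef q)).
    by rewrite fmorph_div /= e mulfK // fmorph_eq0 lead_coef_eq0.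
  - move=> i; rewrite coefB coefZ !coef_map /=.
    by apply: subfieldB; [|apply: subfieldM => //]; exact: subfield_const.
  - rewrite hornerD hornerN hornerZ -!/(psubst _ _) !psubst_id eC.
    by rewrite divfK ?subrr // tofrac_eq0.
(* Divisibility by a relation of minimal size: long division by [m] stays over
   [L], so that it can be done by induction on the size of [h]. *)
exists m; split=> // h; have [k] := ubnP (size h).
elim: k h => // k IH h lek Lh hz.
have [->|h0] := eqVneq h 0; first exact: dvdp0.
have le_mh : (size m <= size h)%N by rewrite sm; apply: min_n; exists h.
have mgt0 : (0 < size m)%N by rewrite size_poly_gt0.
have hgt0 : (0 < size h)%N by rewrite size_poly_gt0.
pose q := (lead_coef h / lead_coef m) *: 'X^(size h - size m).
have Lq : forall i, L (q * m)`_i.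
  move=> i; rewrite -scalerAl coefZ coefXnM.
  apply: (subfieldM subL).
    by apply: (subfieldM subL); [exact: Lh | exact/(subfieldV subL)/Lm].
  by case: ifP => // _; exact: subfield0.
have : m %| h - q * m.
  apply: IH.
  - apply: leq_trans (_ : size h <= k)%N; last by rewrite -ltnS.
    rewrite -[leqRHS](prednK hgt0) ltnS; apply/leq_sizeP => j lej.
    rewrite coefB -scalerAl coefZ coefXnM ltnNge.
    have -> : (size h - size m <= j)%N.
      by apply: leq_trans lej; rewrite -subn1 leq_sub2l.
    move: lej; rewrite leq_eqVlt => /predU1P [<-|]; last first.
      rewrite prednK // => lej; rewrite !nth_default ?mulr0 ?subrr //; last first.
        by rewrite leq_subRL ?subnK // (leq_trans _ lej) // leq_subr.
    have -> : ((size h).-1 - (size h - size m) = (size m).-1)%N.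
      by rewrite -!subn1 subnAC subKn.
    by rewrite /= divfK ?subrr // lead_coef_eq0.
  - by move=> i; rewrite coefB; exact: subfieldB.
  - by rewrite hornerD hornerN hornerM mz mulr0 subr0.
by rewrite dvdp_subl // dvdp_mull.
Qed.

End Subfield.

(** The cofactor identity [h = u m], after clearing the denominators. *)
Lemma scale_cofactor (F : fieldType) (b c d x : F) (g h u m u1 m1 : {poly F}) :
  g = x *: h -> h = u * m -> b *: u = u1 -> c *: m = d *: m1 ->
  (b * c)%:P * g = (x * d)%:P * u1 * m1.
Proof.
move=> -> -> <- em; rewrite !mul_polyC -[in RHS]scalerA -[RHS]scalerAl.
rewrite -[X in _ = _ *: X]scalerAl [in RHS]scalerAr -em.
by rewrite -!scalerAl -!scalerAr !scalerA; congr (_ *: _); rewrite mulrC mulrA.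
Qed.

Section TwoVariable.
Variables (K : fieldType) (p q : {poly K}).

Lemma map_tofrac_inj : injective (map_poly (@FracField.tofrac {poly K})).
Proof.
by apply: map_inj_poly => [x y /eqP|]; rewrite ?tofrac_eq ?tofrac0 // => /eqP.
Qed.

(** For [W = p / q], the two-variable form [p(T) q(z) - p(z) q(T)] of the
    relation [p(T) - W q(T)] satisfied by [z]; the outer variable is [T]. *)
Definition cross_poly : {poly {poly K}} := q%:P * p^:P - p%:P * q^:P.

Lemma coef_cross_poly i : cross_poly`_i = q * (p`_i)%:P - p * (q`_i)%:P.
Proof. by rewrite coefB !coefCM !coef_map. Qed.

Lemma horner_cross_poly t :
  cross_poly.[t%:P] = q * p.[t]%:P - p * q.[t]%:P.
Proof. by rewrite hornerD hornerN !hornerM !hornerC !horner_map. Qed.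

Lemma swap_cross_poly : swapXY cross_poly = - cross_poly.
Proof.
apply/polyP => i; apply/polyP => j; rewrite coef_swapXY !coefN.
rewrite !coef_cross_poly !coefB !coefMC opprB.
by rewrite [q`_i * _]mulrC [p`_i * _]mulrC.
Qed.

Lemma map_cross_poly : q != 0 ->
  map_poly (@FracField.tofrac {poly K}) cross_poly =
  q%:F *: (map_poly (@rconst K) p - (p%:F / q%:F) *: map_poly (@rconst K) q).
Proof.
move=> q0; apply/polyP => i; rewrite coef_map /= coef_cross_poly.
rewrite coefZ coefB coefZ !coef_map /= tofracB !tofracM mulrBr.
by rewrite mulrA [q%:F * (_ / _)]mulrC divfK ?tofrac_eq0.
Qed.

Hypotheses (q0 : q != 0) (ncW : nonconstant (p%:F / q%:F)).

Lemma cross_poly_indep a b : q * a%:P - p * b%:P = 0 -> a = 0 /\ b = 0.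
Proof.
move=> /eqP; rewrite subr_eq0 => /eqP e.
have b0 : b = 0.
  apply/eqP; apply: contrapT => /negP b0; apply: (ncW (c := a / b)).
  rewrite fmorph_div /=; apply/eqP; rewrite eqr_div ?tofrac_eq0 ?polyC_eq0 //.
  by rewrite -!tofracM -e mulrC.
move: e; rewrite {}b0 polyC0 mulr0 => /eqP.
by rewrite mulf_eq0 (negPf q0) polyC_eq0 => /eqP.
Qed.

Lemma size_cross_poly : size cross_poly = maxn (size p) (size q).
Proof.
have coef0 i : cross_poly`_i = 0 -> p`_i = 0 /\ q`_i = 0.
  by rewrite coef_cross_poly => /cross_poly_indep.
apply/eqP; rewrite eqn_leq; apply/andP; split.
  apply/leq_sizeP => j; rewrite geq_max => /andP [lep leq].
  by rewrite coef_cross_poly !nth_default // !mulr0 subrr.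
rewrite geq_max; apply/andP; split; apply/leq_sizeP => j lej.
  by have [] := coef0 j (nth_default 0 lej).
by have [] := coef0 j (nth_default 0 lej).
Qed.

End TwoVariable.

Section Luroth.
Variables (K : closedFieldType) (L : ratfun K -> Prop).
Hypothesis subL : is_subfield L.
Local Notation z := ('X%:F : ratfun K).
Local Notation frac := (@FracField.tofrac {poly K}).

(** If all these ratios were constant, [z] would be algebraic over the
    constants. *)
Lemma minimal_relation_nonconstant (m : {poly ratfun K}) :
  minimal_relation L m -> exists i, nonconstant (m`_i / lead_coef m).
Proof.
move=> [m0 _ mz _]; apply: contrapT => none.
have lm0 : lead_coef m != 0 by rewrite lead_coef_eq0.
have /choice [f ef] : forall i, exists c, m`_i / lead_coef m = rconst c.
  move=> i; apply: contrapT => nc; apply: none; exists i => c e.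
  by apply: nc; exists c.
pose m' := \poly_(i < size m) f i.
have em : m = lead_coef m *: map_poly (@rconst K) m'.
  apply/polyP => i; rewrite coefZ coef_map /= coef_poly.
  case: ltnP => [_|lei]; last by rewrite nth_default // rmorph0 mulr0.
  by rewrite -ef mulrC divfK.
move: mz; rewrite em hornerZ -/(psubst _ _) psubst_id => /eqP.
rewrite mulf_eq0 (negPf lm0) tofrac_eq0 /= => /eqP m'0.
by move: m0; rewrite em m'0 rmorph0 scaler0 eqxx.
Qed.

(** The degree of the variable over [L] is the degree of a coefficient of its
    minimal polynomial. *)
Lemma minimal_relation_size (m : {poly ratfun K}) : minimal_relation L m ->
  exists p q, [/\ q != 0, nonconstant (p%:F / q%:F), L (p%:F / q%:F)
    & size m = maxn (size p) (size q)].
Proof.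
move=> minm; have [i nci] := minimal_relation_nonconstant minm.
have [m0 Lm mz mdvd] := minm.
have lm0 : lead_coef m != 0 by rewrite lead_coef_eq0.
have LW : L (m`_i / lead_coef m).
  by apply: (subfieldM subL) => //; exact/(subfieldV subL)/Lm.
have [p [q [q0 copq eW]]] := ratfun_frac (m`_i / lead_coef m).
rewrite eW in nci LW; exists p, q; split=> //.
have p0 : p != 0.
  by have := nonconstant_neq0 nci; apply: contraNneq => ->; rewrite tofrac0 mul0r.
have [c [M [c0 eM]]] := clear_denominators m.
have M0 : M != 0.
  apply: contraNneq m0 => M0; move: eM; rewrite M0 rmorph0 => /eqP.
  by rewrite scaler_eq0 tofrac_eq0 (negPf c0).
have [|d [N0 [d0 eN prim]]] := @primitive_part _ (swapXY M).
  by rewrite swapXY_eq0.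
have N00 : N0 != 0 by apply: contraNneq (prim 0) => ->; rewrite horner0.
have eM0 : M = d%:P * swapXY N0.
  by rewrite -[M]swapXYK eN rmorphM /= swapXY_map_polyC.
have em : c%:F *: m = d%:F *: map_poly frac (swapXY N0).
  by rewrite eM eM0 rmorphM /= map_polyC /= mul_polyC.
have sm : size m = size (swapXY N0).
  rewrite -(size_scale m (_ : c%:F != 0)) ?tofrac_eq0 // em.
  rewrite size_scale ?tofrac_eq0 // size_map_inj_poly ?tofrac0 //.
  by move=> x y /eqP; rewrite tofrac_eq => /eqP.
have coefm j : c%:F * m`_j = d%:F * ((swapXY N0)`_j)%:F.
  by rewrite -coefZ em coefZ coef_map.
set k := (size m).-1.
(* The two coefficients in the ratio [W] are multiples of [p] and [q]. *)
have epq : p * (swapXY N0)`_k = q * (swapXY N0)`_i.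
  have e : p%:F * m`_k = q%:F * m`_i.
    apply/eqP; rewrite -/(lead_coef m) eq_sym [X in X == _]mulrC.
    by rewrite -eqr_div ?tofrac_eq0 // eW.
  apply/eqP; rewrite -tofrac_eq !tofracM.
  have dF0 : d%:F != 0 :> ratfun K by rewrite tofrac_eq0.
  apply/eqP/(mulfI dF0); rewrite mulrCA -coefm mulrCA e mulrCA coefm.
  by rewrite mulrCA.
have Mk0 : (swapXY N0)`_k != 0.
  by rewrite /k sm -/(lead_coef _) lead_coef_eq0 swapXY_eq0.
have Mi0 : (swapXY N0)`_i != 0.
  apply: contraTneq Mk0 => Mi0; move/eqP: epq; rewrite Mi0 mulr0 mulf_eq0.
  by rewrite (negPf p0) => /= ->.
have sN0 j : (size ((swapXY N0)`_j)%R <= size N0)%N.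
  by rewrite -[in leqRHS](swapXYK N0) -sizeYE max_size_coefXY.
have le_N0 : (maxn (size p) (size q) <= size N0)%N.
  rewrite geq_max; apply/andP; split.
    apply: leq_trans (sN0 i); apply: dvdp_leq => //.
    by rewrite -(Gauss_dvdpr _ copq) -epq dvdp_mulr.
  apply: leq_trans (sN0 k); apply: dvdp_leq => //.
  have copqp : coprimep q p by rewrite coprimep_sym.
  by rewrite -(Gauss_dvdpr _ copqp) epq dvdp_mulr.
pose h := map_poly (@rconst K) p - (p%:F / q%:F) *: map_poly (@rconst K) q.
have [||Q eh] := dvdpP _ _ (mdvd h _ _).
- move=> j; rewrite coefB coefZ !coef_map /=.
  apply: (subfieldB subL); last apply: (subfieldM subL) => //.
    exact: (subfield_const subL).
  exact: (subfield_const subL).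
- rewrite hornerD hornerN hornerZ -!/(psubst _ _) !psubst_id.
  by rewrite divfK ?tofrac_eq0 // subrr.
have [b [Q1 [b0 eQ]]] := clear_denominators Q.
pose P := cross_poly p q.
have eP : (b * c)%:P * P = (q * d)%:P * Q1 * swapXY N0.
  apply: map_tofrac_inj.
  rewrite [LHS]rmorphM [RHS]rmorphM /= [map_poly _ (_ * Q1)]rmorphM /=.
  rewrite !map_polyC /= !tofracM.
  exact: scale_cofactor (map_cross_poly p q0) eh eQ em.
have {}eP : N0 * swapXY ((q * d)%:P * Q1) = (b * c)^:P * swapXY P.
  by rewrite -swapXY_polyC -rmorphM /= eP [in RHS]rmorphM /= swapXYK mulrC.
have [|Q' eP'] := primitive_dvd _ prim eP; first exact: mulf_neq0.
(* Both [P] and the primitive factor [N0] have degree [max (deg p) (deg q)] in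
   [z], so that the cofactor [Q'] only depends on [T]. *)
have sP : size (swapXY P) = maxn (size p) (size q).
  by rewrite swap_cross_poly size_polyN size_cross_poly.
have P0 : swapXY P != 0.
  by rewrite -size_poly_gt0 sP leq_max size_poly_gt0 p0.
have Q'0 : Q' != 0 by apply: contraNneq P0 => Q'0; rewrite -eP' Q'0 mulr0.
have /size_poly1P [w w0 eQ'] : size Q' == 1.
  rewrite eqn_leq size_poly_gt0 Q'0 andbT -(leq_add2l (size N0)) addn1.
  have := size_mul N00 Q'0; rewrite eP' sP => e.
  move: le_N0; rewrite e.
  by case: (_ + _)%N.
have {}eP' : swapXY N0 * w^:P = P.
  by rewrite -[P]swapXYK -eP' rmorphM /= eQ' swapXY_polyC.
(* At a root [t] of the cofactor, [p] and [q] would both vanish. *)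
have /size_poly1P [x x0 ew] : size w == 1.
  apply/negPn/negP => /closed_rootP [t rt].
  have : (cross_poly p q).[t%:P] = 0.
    by rewrite -/P -eP' hornerM horner_map /= (rootP rt) mulr0.
  rewrite horner_cross_poly => /(cross_poly_indep q0 nci) [pt qt].
  by have := coprimep_root copq (introT rootP pt); rewrite qt eqxx.
rewrite sm -(size_cross_poly q0 nci) -/P -eP' ew map_polyC /=.
by rewrite mulrC size_Cmul // polyC_eq0.
Qed.

(** Lueroth's theorem: a subfield that contains a nonconstant function is
    generated by one function. *)
Theorem Luroth C : L C -> nonconstant C ->
  exists W, [/\ nonconstant W, L W
    & forall F, L F -> exists G, F = rcomp G W].
Proof.
move=> LC ncC; have [m minm] := exists_minimal_relation subL LC ncC.
have [p [q [q0 ncW LW sm]]] := minimal_relation_size minm.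
have [m0 Lm mz mdvd] := minm; set W := p%:F / q%:F in ncW LW.
exists W; split=> // F LF.
(* [h] is the relation [p(T) - W q(T)] of [z] over the field of the functions
   of [W], where [W] is replaced by an independent variable. *)
pose h := map_poly (@rconst K) p - z *: map_poly (@rconst K) q.
have coefh i : h`_i = rconst p`_i - z * rconst q`_i.
  by rewrite coefB coefZ !coef_map.
have hz : (map_poly (csubst ncW) h).[z] = 0.
  rewrite rmorphB /= map_polyZ hornerD hornerN hornerZ /= csubstX.
  have e (f : {poly K}) :
      (map_poly (csubst ncW) (map_poly (@rconst K) f)).[z] = f%:F.
    rewrite -[RHS]psubst_id /psubst; congr (_.[_]).
    by apply/polyP => i; rewrite !coef_map /= csubst_const.
  by rewrite !e /W divfK ?tofrac_eq0 // subrr.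
have sh : (size h <= size m)%N.
  rewrite sm; apply/leq_sizeP => j; rewrite geq_max => /andP [lep leq].
  by rewrite coefh !nth_default // rmorph0 mulr0 subrr.
have h0 : h != 0.
  have lq0 : lead_coef q != 0 by rewrite lead_coef_eq0.
  apply/eqP => h0; apply: (@nonconstantX K (p`_(size q).-1 / lead_coef q)).
  have /eqP := coefh (size q).-1; rewrite h0 coef0 eq_sym subr_eq0 => /eqP e.
  by rewrite fmorph_div /= e mulfK // fmorph_eq0.
have reduce (f : {poly K}) : exists r : {poly ratfun K},
    (size r < size m)%N /\ (map_poly (csubst ncW) r).[z] = f%:F.
  exists (map_poly (@rconst K) f %% h); split.
    by apply: leq_trans sh; rewrite ltn_modp.
  rewrite -[RHS]psubst_id.
  have -> : psubst f z = (map_poly (csubst ncW) (map_poly (@rconst K) f)).[z].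
    by rewrite /psubst; congr (_.[_]); apply/polyP => i;
      rewrite !coef_map /= csubst_const.
  rewrite {2}[map_poly (@rconst K) f](divp_eq _ h) rmorphD rmorphM /=.
  by rewrite hornerD hornerM hz mulr0 add0r.
have Lcomp G : L (csubst ncW G).
  have [a [b [b0 _ ->]]] := ratfun_frac G; rewrite /csubst rcompE //.
  apply: (subfieldM subL); first exact: subfield_psubst.
  by apply: (subfieldV subL); exact: subfield_psubst.
(* For [F = f / g], reducing [f] and [g] modulo [h] turns [f - F g = 0] into a
   relation of [z] over [L] that is shorter than [m], hence trivial. *)
have [f [g [g0 _ eF]]] := ratfun_frac F.
have [r [sr ef]] := reduce f; have [s [ss eg]] := reduce g.
pose u := map_poly (csubst ncW) r - F *: map_poly (csubst ncW) s.
have u0 : u = 0.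
  apply: contraTeq (_ : (size u < size m)%N) => [u0|].
    rewrite -leqNgt; apply: dvdp_leq => //; apply: mdvd => [i|].
      rewrite coefB coefZ !coef_map /=; apply: (subfieldB subL) => //.
      exact: (subfieldM subL).
    by rewrite hornerD hornerN hornerZ ef eg eF divfK ?tofrac_eq0 // subrr.
  rewrite (leq_ltn_trans (size_polyD _ _)) // gtn_max size_polyN.
  rewrite size_map_poly sr /= (leq_ltn_trans (size_scale_leq _ _)) //.
  by rewrite size_map_poly.
have s0 : s != 0.
  apply: contraNneq g0 => s0; move/eqP: eg.
  by rewrite s0 rmorph0 horner0 eq_sym tofrac_eq0.
exists (r`_(size s).-1 / lead_coef s); rewrite -/(csubst ncW _) fmorph_div /=.
have /eqP := congr1 (fun u : {poly ratfun K} => u`_(size s).-1) u0.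
rewrite coef0 coefB coefZ !coef_map /= subr_eq0 => /eqP ->.
by rewrite mulfK // fmorph_eq0 lead_coef_eq0.
Qed.

End Luroth.

(** * Values and orders at a finite point *)

Section Values.
Variables (K : fieldType) (g : K).
Implicit Types (F G : ratfun K) (c d : K).

(** [has_value F c]: the function [F] has no pole at [g], and takes the value
    [c] there. *)
Definition has_value F c : Prop := exists a b : {poly K},
  [/\ b.[g] != 0, F = a%:F / b%:F & c = a.[g] / b.[g]].

Definition regular F : Prop := exists c, has_value F c.

(** The uniformizer at [g]. *)
Definition unif : ratfun K := ('X - g%:P)%:F.

Lemma horner_neq0 (b : {poly K}) : b.[g] != 0 -> b%:F != 0 :> ratfun K.
Proof.
by rewrite tofrac_eq0; apply: contraNneq => ->; rewrite horner0.
Qed.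

Lemma has_value_poly (p : {poly K}) : has_value p%:F p.[g].
Proof.
by exists p, 1; rewrite hornerC oner_neq0 tofrac1 !divr1.
Qed.

Lemma has_value_const c : has_value (rconst c) c.
Proof. by have := has_value_poly c%:P; rewrite hornerC. Qed.

Lemma has_value_unif : has_value unif 0.
Proof. by have := has_value_poly ('X - g%:P); rewrite hornerXsubC subrr. Qed.

Lemma unif_neq0 : unif != 0.
Proof. by rewrite tofrac_eq0 polyXsubC_eq0. Qed.

Lemma has_valueD F G c d :
  has_value F c -> has_value G d -> has_value (F + G) (c + d).
Proof.
move=> [a [b [b0 -> ->]]] [a' [b' [b'0 -> ->]]].
exists (a * b' + a' * b), (b * b').
rewrite !(hornerD, hornerM) mulf_neq0 //; split=> //.
  by rewrite addf_div ?horner_neq0 // -!tofracM -tofracD.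
by rewrite addf_div.
Qed.

Lemma has_valueM F G c d :
  has_value F c -> has_value G d -> has_value (F * G) (c * d).
Proof.
move=> [a [b [b0 -> ->]]] [a' [b' [b'0 -> ->]]].
exists (a * a'), (b * b').
rewrite !hornerM mulf_neq0 //; split=> //.
  by rewrite mulf_div -!tofracM.
by rewrite mulf_div.
Qed.

Lemma has_valueN F c : has_value F c -> has_value (- F) (- c).
Proof.
move=> [a [b [b0 -> ->]]]; exists (- a), b.
by rewrite hornerN tofracN !mulNr.
Qed.

Lemma has_valueB F G c d :
  has_value F c -> has_value G d -> has_value (F - G) (c - d).
Proof. by move=> hF hG; apply: has_valueD => //; exact: has_valueN. Qed.

Lemma has_valueX F c n : has_value F c -> has_value (F ^+ n) (c ^+ n).
Proof.
move=> hF; elim: n => [|n IH]; last by rewrite !exprS; exact: has_valueM.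
by rewrite !expr0 -[1](rmorph1 (@rconst K)); exact: has_value_const.
Qed.

Lemma has_value0 : has_value 0 0.
Proof. by have := has_value_const 0; rewrite rmorph0. Qed.

Lemma has_value_sum (I : eqType) (s : seq I) (P : pred I) (f : I -> ratfun K)
    (v : I -> K) :
  (forall i, i \in s -> P i -> has_value (f i) (v i)) ->
  has_value (\sum_(i <- s | P i) f i) (\sum_(i <- s | P i) v i).
Proof.
elim: s => [|i s IH] hv; first by rewrite !big_nil; exact: has_value0.
have {}IH : has_value (\sum_(i <- s | P i) f i) (\sum_(i <- s | P i) v i).
  by apply: IH => j js; apply: hv; rewrite inE js orbT.
rewrite !big_cons; case: ifP => // Pi; apply: has_valueD => //.
by apply: hv => //; rewrite mem_head.
Qed.

Lemma has_valueV F c : c != 0 -> has_value F c -> has_value F^-1 c^-1.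
Proof.
move=> c0 [a [b [b0 -> e]]]; exists b, a; rewrite e !invf_div; split=> //.
by apply: contraNneq c0 => a0; rewrite e a0 mul0r.
Qed.

Lemma has_value_uniq F c d : has_value F c -> has_value F d -> c = d.
Proof.
move=> [a [b [b0 -> ->]]] [a' [b' [b'0 e ->]]].
apply/eqP; rewrite eqr_div // -!hornerM.
move/eqP: e; rewrite eqr_div ?horner_neq0 // -!tofracM tofrac_eq.
by move=> /eqP ->.
Qed.

Lemma poly_order (p : {poly K}) : p != 0 ->
  exists m q, q.[g] != 0 /\ p = q * ('X - g%:P) ^+ m.
Proof.
move=> p0; have [m [q]] := multiplicity_XsubC p g.
by rewrite p0 /= => rq ->; exists m, q.
Qed.

Lemma regular_order F c : F != 0 -> has_value F c ->
  exists m u d, [/\ d != 0, has_value u d & F = unif ^+ m * u].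
Proof.
move=> F0 [a [b [b0 eF _]]].
have a0 : a != 0 by apply: contraNneq F0 => a0; rewrite eF a0 tofrac0 mul0r.
have [m [q [q0 ea]]] := poly_order a0.
exists m, (q%:F / b%:F), (q.[g] / b.[g]).
split; [by rewrite mulf_neq0 ?invr_eq0 | by exists q, b |].
by rewrite eF ea tofracM tofracXn mulrA [_ * q%:F]mulrC.
Qed.

Lemma regular_or_pole F : regular F \/ has_value F^-1 0.
Proof.
have [p [q [q0 cop ->]]] := ratfun_frac F.
have [q'0|q'0] := eqVneq q.[g] 0; last by left; exists (p.[g] / q.[g]), p, q.
right; exists q, p; rewrite invf_div q'0 mul0r; split=> //.
by apply: coprimep_root (introT rootP q'0); rewrite coprimep_sym.
Qed.

(** The order at [g] is well defined. *)
Lemma order_uniq m m' u u' c c' : c != 0 -> c' != 0 ->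
  has_value u c -> has_value u' c' -> unif ^+ m * u = unif ^+ m' * u' -> m = m'.
Proof.
move=> c0 c'0.
wlog le_m : m m' u u' c c' c0 c'0 / (m <= m')%N => [wh hu hu' e|].
  case: (leqP m m') => [le_m|/ltnW le_m]; first exact: (wh m m' u u' c c').
  by apply/esym; apply: (wh m' m u' u c' c).
move=> hu hu'; rewrite -(subnK le_m) addnC exprD -mulrA.
move=> /(mulfI (expf_neq0 _ unif_neq0)) e.
case: (m' - m)%N e => [|k] e; first by rewrite addn0.
have hk : has_value (unif ^+ k.+1) 0.
  by have := has_valueX k.+1 has_value_unif; rewrite expr0n.
have := has_value_uniq hu; rewrite e => /(_ _ (has_valueM hk hu')) c_eq0.
by move: c0; rewrite c_eq0 mul0r eqxx.
Qed.

Lemma has_value0_unif G : has_value (unif * G) 0 -> regular G.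
Proof.
move=> [a [b [b0 eG /esym/eqP]]]; rewrite mulf_eq0 invr_eq0 (negPf b0) orbF.
move=> ra; have [a' ea] := factor_theorem _ _ ra.
exists (a'.[g] / b.[g]), a', b; split=> //; apply: (mulfI unif_neq0).
by rewrite eG ea tofracM [a'%:F * _]mulrC mulrA.
Qed.

Lemma regular_const c : regular (rconst c).
Proof. by exists c; exact: has_value_const. Qed.

Lemma regularD F G : regular F -> regular G -> regular (F + G).
Proof. by move=> [c hc] [d hd]; exists (c + d); exact: has_valueD. Qed.

Lemma regularB F G : regular F -> regular G -> regular (F - G).
Proof. by move=> [c hc] [d hd]; exists (c - d); exact: has_valueB. Qed.

Lemma regularM F G : regular F -> regular G -> regular (F * G).
Proof. by move=> [c hc] [d hd]; exists (c * d); exact: has_valueM. Qed.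

End Values.

Arguments unif {K} g.

(** * Homogenized polynomial relations *)

Section Homogeneous.
Variables (K : fieldType) (g : K).
Implicit Types (A : {poly K}) (x F : ratfun K).

(** [x ^+ n * A(F)] as a homogeneous form in [x * F] and [x]. *)
Lemma psubst_homogeneous A n x F : size A = n.+1 ->
  x ^+ n * psubst A F =
  rconst (lead_coef A) * (x * F) ^+ n
    + \sum_(i < n) rconst A`_i * (x * F) ^+ i * x ^+ (n - i).
Proof.
move=> sA; rewrite psubstE sA big_ord_recr /= mulrDr addrC /lead_coef sA.
congr (_ + _); first by rewrite mulrCA exprMn.
rewrite mulr_sumr; apply: eq_bigr => i _.
rewrite exprMn -{1}(subnK (ltnW (ltn_ord i))) exprD.
by rewrite -[LHS]mulrA [LHS]mulrC; congr (_ * _); rewrite mulrCA.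
Qed.

(** The leading term of [A] at a pole of [F] that [x] cancels. *)
Lemma has_value_homogeneous A n x F c : size A = n.+1 ->
  has_value g x 0 -> has_value g (x * F) c ->
  has_value g (x ^+ n * psubst A F) (lead_coef A * c ^+ n).
Proof.
move=> sA hx hF; rewrite (psubst_homogeneous _ _ sA).
rewrite -[X in has_value _ _ X]addr0.
apply: has_valueD.
  by apply: has_valueM; [exact: has_value_const | exact: has_valueX].
rewrite -[X in has_value _ _ X](_ :
  \sum_(i < n) A`_i * c ^+ i * 0 ^+ (n - i) = 0).
  apply: has_value_sum => i _ _; apply: has_valueM; last exact: has_valueX.
  by apply: has_valueM; [exact: has_value_const | exact: has_valueX].
by rewrite big1 // => i _; rewrite expr0n subn_eq0 leqNgt ltn_ord mulr0.
Qed.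

(** The regular functions are integrally closed; for [x = 1], a polynomial in
    [F] has a pole wherever [F] has one. *)
Lemma regular_homogeneous A n x F : size A = n.+1 -> (0 < n)%N ->
  regular g x -> regular g (x ^+ n * psubst A F) -> regular g (x * F).
Proof.
move=> sA n0 [a hx] [c hc]; have [//|hV] := regular_or_pole g (x * F).
set V := (x * F)^-1 in hV.
have [V0|V0] := eqVneq V 0.
  exists 0; move/eqP: V0; rewrite invr_eq0 => /eqP ->; exact: has_value0.
have lA0 : lead_coef A != 0 by rewrite lead_coef_eq0 -size_poly_gt0 sA.
have VF i : V ^+ i * (x * F) ^+ i = 1.
  have xF0 : x * F != 0 by rewrite -invr_eq0.
  by rewrite -exprMn (mulVf xF0) expr1n.
suff : lead_coef A = 0 by move/eqP: lA0.
apply: (has_value_uniq (g := g) (F := rconst (lead_coef A))).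
  exact: has_value_const.
have -> : rconst (lead_coef A) = V ^+ n * (x ^+ n * psubst A F)
    - \sum_(i < n) rconst A`_i * V ^+ (n - i) * x ^+ (n - i).
  rewrite (psubst_homogeneous _ _ sA) mulrDr mulrCA VF mulr1 -addrA.
  rewrite mulr_sumr -sumrB big1 ?addr0 // => i _; apply/eqP; rewrite subr_eq0.
  rewrite -{1}(subnK (ltnW (ltn_ord i))) exprD -!mulrA; apply/eqP.
  rewrite [V ^+ i * _]mulrCA [V ^+ i * _]mulrA VF mul1r.
  by rewrite mulrCA.
rewrite -[X in has_value _ _ X]subr0; apply: has_valueB.
  have := has_valueM (has_valueX n hV) hc.
  by rewrite expr0n -leqn0 leqNgt n0 mul0r.
rewrite -[X in has_value _ _ X](_ :
  \sum_(i < n) A`_i * 0 ^+ (n - i) * a ^+ (n - i) = 0).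
  apply: has_value_sum => i _ _; apply: has_valueM; last exact: has_valueX.
  by apply: has_valueM; [exact: has_value_const | exact: has_valueX].
by rewrite big1 // => i _; rewrite expr0n subn_eq0 leqNgt ltn_ord mulr0 mul0r.
Qed.

End Homogeneous.

(** * Subfields generated by two functions *)

(** The subring generated by [X], [Y] and the constants. *)
Inductive subring_gen (K : fieldType) (X Y : ratfun K) : ratfun K -> Prop :=
| Gen_const c : subring_gen X Y (rconst c)
| Gen_fst : subring_gen X Y X
| Gen_snd : subring_gen X Y Y
| Gen_add F G : subring_gen X Y F -> subring_gen X Y G ->
    subring_gen X Y (F + G)
| Gen_mul F G : subring_gen X Y F -> subring_gen X Y G ->
    subring_gen X Y (F * G).

(** Its field of fractions. *)
Definition subfield_gen (K : fieldType) (X Y F : ratfun K) : Prop :=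
  exists f h, [/\ subring_gen X Y f, subring_gen X Y h, h != 0 & F = f / h].

Section Generated.
Variables (K : fieldType) (X Y : ratfun K).
Local Notation gen := (subring_gen X Y).

Lemma gen0 : gen 0.
Proof. by have := Gen_const X Y 0; rewrite rmorph0. Qed.

Lemma gen1 : gen 1.
Proof. by have := Gen_const X Y 1; rewrite rmorph1. Qed.

Lemma gen_exp F n : gen F -> gen (F ^+ n).
Proof.
by move=> gF; elim: n => [|n IH]; [exact: gen1 | rewrite exprS; exact: Gen_mul].
Qed.

Lemma gen_sub F G : gen F -> gen G -> gen (F - G).
Proof.
move=> gF gG; apply: Gen_add => //.
rewrite -mulN1r -[-1](rmorphN1 (@rconst K)).
by apply: Gen_mul => //; exact: Gen_const.
Qed.

Lemma gen_sum n (f : 'I_n -> ratfun K) :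
  (forall i, gen (f i)) -> gen (\sum_(i < n) f i).
Proof.
by move=> gf; apply: big_ind => [||i _] //; [exact: gen0 | exact: Gen_add].
Qed.

Lemma gen_subfield F : gen F -> subfield_gen X Y F.
Proof.
by move=> gF; exists F, 1; rewrite oner_neq0 divr1; split=> //; exact: gen1.
Qed.

Lemma subfield_gen_is_subfield : is_subfield (subfield_gen X Y).
Proof.
split=> [c|F G|F G|F].
- by apply: gen_subfield; exact: Gen_const.
- move=> [f [h [gf gh h0 ->]]] [f' [h' [gf' gh' h'0 ->]]].
  exists (f * h' + f' * h), (h * h'); rewrite (mulf_neq0 h0 h'0).
  rewrite (addf_div _ _ h0 h'0).
  by split; [apply: Gen_add; exact: Gen_mul | exact: Gen_mul | |].
- move=> [f [h [gf gh h0 ->]]] [f' [h' [gf' gh' h'0 ->]]].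
  exists (f * f'), (h * h'); rewrite (mulf_neq0 h0 h'0) mulf_div.
  by split; [exact: Gen_mul | exact: Gen_mul | |].
- move=> [f [h [gf gh h0 ->]]]; have [->|f0] := eqVneq f 0.
    by rewrite mul0r invr0; apply: gen_subfield; exact: gen0.
  by exists h, f; rewrite invf_div.
Qed.

End Generated.

Lemma csubst_gen (K : closedFieldType) (W : ratfun K) (ncW : nonconstant W)
    X Y F : subring_gen (csubst ncW X) (csubst ncW Y) F ->
  exists G, subring_gen X Y G /\ F = csubst ncW G.
Proof.
elim=> [c|||F1 G1 _ [F2 [gF ->]] _ [G2 [gG ->]]
        |F1 G1 _ [F2 [gF ->]] _ [G2 [gG ->]]].
- by exists (rconst c); rewrite csubst_const; split=> //; exact: Gen_const.
- by exists X; split=> //; exact: Gen_fst.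
- by exists Y; split=> //; exact: Gen_snd.
- by exists (F2 + G2); rewrite rmorphD; split=> //; exact: Gen_add.
- by exists (F2 * G2); rewrite rmorphM; split=> //; exact: Gen_mul.
Qed.

Lemma gen_csubst (K : closedFieldType) (W : ratfun K) (ncW : nonconstant W)
    X Y F : subring_gen X Y F ->
  subring_gen (csubst ncW X) (csubst ncW Y) (csubst ncW F).
Proof.
elim=> [c|||F1 G1 _ gF _ gG|F1 G1 _ gF _ gG].
- by rewrite csubst_const; exact: Gen_const.
- exact: Gen_fst.
- exact: Gen_snd.
- by rewrite rmorphD; exact: Gen_add.
- by rewrite rmorphM; exact: Gen_mul.
Qed.

Lemma subfield_gen_csubst (K : closedFieldType) (W : ratfun K)
    (ncW : nonconstant W) X Y F :
  subfield_gen (csubst ncW X) (csubst ncW Y) (csubst ncW F) <->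
  subfield_gen X Y F.
Proof.
split=> [[f [h [/csubst_gen [f' [gf ->]] /csubst_gen [h' [gh ->]] h0 e]]]|].
  move: h0; rewrite fmorph_eq0 => h0; exists f', h'; split; [done..|].
  by apply: (@csubst_inj _ _ ncW); rewrite e fmorph_div.
move=> [f [h [gf gh h0 ->]]]; exists (csubst ncW f), (csubst ncW h).
by rewrite fmorph_div fmorph_eq0; split; [exact: gen_csubst.. | |].
Qed.

(** * Simple poles *)

Section Orders.
Variables (K : fieldType) (g : K) (X Y : ratfun K) (c : K).
Variables (k : nat) (u0 : ratfun K) (c0 : K) (G1 G2 : ratfun K) (c1 : K).
Hypotheses (k0 : (0 < k)%N) (c00 : c0 != 0) (hu0 : has_value g u0 c0).
Hypotheses (eX : X = unif g ^+ k * u0) (hY : has_value g Y c).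
Hypotheses (gG1 : subring_gen X Y G1) (gG2 : subring_gen X Y G2).
Hypotheses (c10 : c1 != 0) (hG1 : has_value g G1 c1).
(** The point [(X, Y)] moves on a curve that is smooth over the [X]-line at
    [(0, c)]. *)
Hypothesis (smooth : (Y - rconst c) * G1 = X * G2).

Lemma has_value_fst : has_value g X 0.
Proof.
have hk := has_valueX k (has_value_unif g).
by have := has_valueM hk hu0; rewrite -eX expr0n -leqn0 leqNgt k0 mul0r.
Qed.

Lemma gen_regular F : subring_gen X Y F -> regular g F.
Proof.
elim=> [d|||F1 F2 _ r1 _ r2|F1 F2 _ r1 _ r2].
- exact: regular_const.
- by exists 0; exact: has_value_fst.
- by exists c.
- exact: regularD.
- exact: regularM.
Qed.

(** Up to the factor [G1], a polynomial in [X] and [Y] is a constant plus a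
    multiple of [X]. *)
Lemma gen_division F : subring_gen X Y F -> exists d F',
  subring_gen X Y F' /\ (F - rconst d) * G1 = X * F'.
Proof.
elim=> [d|||F1 F2 g1 [d1 [F1' [g1' e1]]] g2 [d2 [F2' [g2' e2]]]
        |F1 F2 g1 [d1 [F1' [g1' e1]]] g2 [d2 [F2' [g2' e2]]]].
- by exists d, 0; rewrite subrr mul0r mulr0; split=> //; exact: gen0.
- by exists 0, G1; rewrite rmorph0 subr0.
- by exists c, G2.
- exists (d1 + d2), (F1' + F2'); split; first exact: Gen_add.
  by rewrite rmorphD opprD addrACA mulrDl e1 e2 mulrDr.
- exists (d1 * d2), (F1' * F2 + rconst d1 * F2'); split.
    by apply: Gen_add; apply: Gen_mul => //; exact: Gen_const.
  have -> : F1 * F2 - rconst (d1 * d2) =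
      (F1 - rconst d1) * F2 + rconst d1 * (F2 - rconst d2).
    by rewrite rmorphM mulrBl mulrBr addrA subrK.
  rewrite mulrDl mulrAC e1 -[rconst d1 * _ * G1]mulrA e2.
  by rewrite -[X * F1' * F2]mulrA [rconst d1 * (X * _)]mulrCA mulrDr.
Qed.

(** The order at [g] of a polynomial in [X] and [Y] is a multiple of the
    order of [X]. *)
Lemma gen_order m F u d : subring_gen X Y F -> d != 0 -> has_value g u d ->
  F = unif g ^+ m * u -> (k %| m)%N.
Proof.
elim/ltn_ind: m F u d => [] [|m] IH F u d gF d0 hu eF; first exact: dvdn0.
have hF : has_value g F 0.
  have hm := has_valueX m.+1 (has_value_unif g).
  by have := has_valueM hm hu; rewrite -eF expr0n mul0r.
have [b [F' [gF' eF']]] := gen_division gF.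
have [a' hF'] := gen_regular gF'.
have b0 : b = 0.
  have := has_valueM has_value_fst hF'; rewrite -eF' mul0r => h0.
  have := has_valueM (has_valueB hF (has_value_const g b)) hG1.
  move=> /has_value_uniq /(_ h0) /eqP.
  by rewrite sub0r mulf_eq0 (negPf c10) orbF oppr_eq0 => /eqP.
have {}eF' : F * G1 = X * F' by rewrite -eF' b0 rmorph0 subr0.
have nz h e : e != 0 -> has_value g h e -> h != 0.
  move=> e0 hh; apply: contraNneq e0 => h0; rewrite h0 in hh.
  by rewrite (has_value_uniq hh (has_value0 g)).
have F'0 : F' != 0.
  apply/eqP => F'0; move/eqP: eF'; rewrite F'0 mulr0 mulf_eq0.
  by rewrite (negPf (nz _ _ c10 hG1)) orbF eF mulf_eq0 (negPf (nz _ _ d0 hu))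
    orbF expf_eq0 (negPf (unif_neq0 g)) andbF.
have [j [u' [d' [d'0 hu' eF2]]]] := regular_order F'0 hF'.
have em : m.+1 = (k + j)%N.
  apply: (order_uniq (mulf_neq0 d0 c10) (mulf_neq0 c00 d'0)
    (has_valueM hu hG1) (has_valueM hu0 hu')).
  by rewrite mulrA -eF eF' eX eF2 exprD mulrACA.
rewrite em dvdn_addr // (IH j _ F' u' d') //.
by rewrite em -[X in (X < _)%N]add0n ltn_add2r.
Qed.

(** If [z] is a quotient of polynomials in [X] and [Y], then [X] has order 1. *)
Lemma gen_order1 : subfield_gen X Y 'X%:F -> k = 1%N.
Proof.
move=> [f [h [gf gh h0 e]]].
pose f' := f - rconst g * h.
have gf' : subring_gen X Y f'.
  by apply: gen_sub => //; apply: Gen_mul => //; exact: Gen_const.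
have ef' : f' = unif g * h.
  by rewrite /f' /unif tofracB mulrBl e divfK.
have [a hh] := gen_regular gh.
have [m [u [d [d0 hu eh]]]] := regular_order h0 hh.
have km : (k %| m)%N by exact: gen_order gh d0 hu eh.
have : (k %| m.+1)%N.
  by apply: gen_order gf' d0 hu _; rewrite ef' eh exprS mulrA.
by rewrite -addn1 dvdn_addr // dvdn1 => /eqP.
Qed.

End Orders.

Lemma regular_psubst (K : fieldType) (g : K) (A : {poly K}) F :
  regular g F -> regular g (psubst A F).
Proof.
move=> rF; elim/poly_ind: A => [|A c IH].
  by rewrite /psubst rmorph0 horner0; exists 0; exact: has_value0.
rewrite psubstD psubstM psubstX psubstC.
by apply: regularD; [exact: regularM | exact: regular_const].
Qed.

(** The identity [A o C = B o D] in the coordinates [1 / C] and [D / C] at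
    infinity: it has the form [(Y - c) G1 = X S], where the value of [G1] at
    [Y = c] is [- lead_coef B * n%:R * c ^+ n.-1]. *)
Lemma smooth_at_infinity (K : fieldType) (A B : {poly K}) (n : nat)
    (C D : ratfun K) (c : K) :
  size A = n.+1 -> size B = n.+1 -> C != 0 ->
  psubst A C = psubst B D -> lead_coef A = lead_coef B * c ^+ n ->
  exists S, subring_gen C^-1 (C^-1 * D) S /\
    (C^-1 * D - rconst c) *
      (rconst (- lead_coef B) *
         \sum_(i < n) (C^-1 * D) ^+ (n.-1 - i) * rconst c ^+ i) = C^-1 * S.
Proof.
move=> sA sB C0 eAB elead; set X := C^-1; set Y := X * D.
exists (\sum_(i < n) (rconst B`_i * Y ^+ i - rconst A`_i) * X ^+ (n - i).-1).
split.
  apply: gen_sum => i; apply: Gen_mul; last by apply: gen_exp; exact: Gen_fst.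
  apply: gen_sub; last exact: Gen_const.
  apply: Gen_mul; first exact: Gen_const.
  by apply: gen_exp; exact: Gen_snd.
rewrite mulrCA -subrXX rmorphN mulNr mulrBr -rmorphXn -rmorphM -elead opprB.
have := psubst_homogeneous X C sA; rewrite eAB (psubst_homogeneous X D sB).
rewrite -/Y [X * C]mulVf // expr1n mulr1 => /eqP.
rewrite [RHS]mulr_sumr => e.
have -> : \sum_(i < n) X * ((rconst B`_i * Y ^+ i - rconst A`_i)
      * X ^+ (n - i).-1) =
    \sum_(i < n) rconst B`_i * Y ^+ i * X ^+ (n - i)
    - \sum_(i < n) rconst A`_i * 1 ^+ i * X ^+ (n - i).
  rewrite -sumrB; apply: eq_bigr => i _.
  rewrite mulrCA -exprS prednK ?subn_gt0 // mulrBl expr1n.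
  by rewrite [rconst A`_i * 1]mulr1.
by apply/eqP; rewrite subr_eq addrAC eq_sym subr_eq addrC.
Qed.

Lemma simple_poles (K : fieldType) (A B : {poly K}) (n : nat) (C D : ratfun K)
    (g : K) :
  size A = n.+1 -> size B = n.+1 -> n%:R != 0 :> K ->
  psubst A C = psubst B D -> subfield_gen C^-1 (C^-1 * D) 'X%:F ->
  regular g (unif g * C) /\ regular g (unif g * D).
Proof.
move=> sA sB nK eAB gX.
have n0 : (0 < n)%N by rewrite lt0n; apply: contraNneq nK => ->.
have rU : regular g (unif g) by exists 0; exact: has_value_unif.
have of_regular : regular g C -> regular g (unif g * C) /\ regular g (unif g * D).
  move=> rC; split; apply: regularM => //.
  rewrite -[D]mul1r; apply: (regular_homogeneous sB n0).
    by rewrite -[1](rmorph1 (@rconst K)); exact: regular_const.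
  by rewrite expr1n mul1r -eAB; exact: regular_psubst.
have [/of_regular //|hX] := regular_or_pole g C.
have [C0|C0] := eqVneq C 0.
  by apply: of_regular; rewrite C0; exists 0; exact: has_value0.
have hXA : has_value g (C^-1 ^+ n * psubst A C) (lead_coef A).
  rewrite -[X in has_value _ _ X]mulr1 -(expr1n _ n).
  apply: has_value_homogeneous => //; rewrite mulVf // -[1](rmorph1 (@rconst K)).
  exact: has_value_const.
have [c hY] : regular g (C^-1 * D).
  apply: (regular_homogeneous sB n0); first by exists 0.
  by rewrite -eAB; exists (lead_coef A).
have elead : lead_coef A = lead_coef B * c ^+ n.
  apply: (has_value_uniq hXA); rewrite eAB.
  exact: has_value_homogeneous.
have lA0 : lead_coef A != 0 by rewrite lead_coef_eq0 -size_poly_gt0 sA.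
have lB0 : lead_coef B != 0 by rewrite lead_coef_eq0 -size_poly_gt0 sB.
have c0 : c != 0.
  apply: contraNneq lA0 => c0; rewrite elead c0 expr0n.
  by rewrite -leqn0 leqNgt n0 mulr0.
have X0 : C^-1 != 0 by rewrite invr_eq0.
have [k [u [d [d0 hu eX]]]] := regular_order X0 hX.
have k0 : (0 < k)%N.
  rewrite lt0n; apply: contraNneq d0 => k0; apply/eqP/(has_value_uniq hu).
  by move: hX; rewrite eX k0 mul1r.
have [S [gS eS]] := smooth_at_infinity sA sB C0 eAB elead.
set G1 := rconst _ * _ in eS.
have gG1 : subring_gen C^-1 (C^-1 * D) G1.
  apply: Gen_mul; first exact: Gen_const.
  apply: gen_sum => i; apply: Gen_mul; apply: gen_exp.
    exact: Gen_snd.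
  exact: Gen_const.
have hG1 : has_value g G1 (- lead_coef B * (c ^+ n.-1 *+ n)).
  apply: has_valueM; first exact: has_value_const.
  rewrite -[n in _ *+ n]card_ord -sumr_const.
  apply: has_value_sum => i _ _.
  have -> : c ^+ n.-1 = c ^+ (n.-1 - i) * c ^+ i.
    by rewrite -exprD subnK // -ltnS prednK.
  apply: has_valueM; apply: has_valueX => //; exact: has_value_const.
have c10 : - lead_coef B * (c ^+ n.-1 *+ n) != 0.
  by rewrite mulf_neq0 ?oppr_eq0 // -mulr_natr mulf_neq0 ?expf_neq0.
have k1 := gen_order1 k0 d0 hu eX hY gG1 gS c10 hG1 eS gX.
have hUC : has_value g (unif g * C) d^-1.
  have -> : unif g * C = u^-1.
    rewrite -[C]invrK eX k1 expr1 invfM mulrA (divff (unif_neq0 g)).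
    by rewrite mul1r.
  exact: has_valueV.
split; first by exists d^-1.
exists (d^-1 * c); have -> : unif g * D = unif g * C * (C^-1 * D).
  by rewrite mulrA (mulfK C0).
exact: has_valueM.
Qed.

(** * Partial fractions *)

Section PartialFractions.
Variable K : closedFieldType.
Implicit Types (F : ratfun K) (s : seq K).

(** A function without finite poles is a polynomial. *)
Lemma regular_everywhere F : (forall g, regular g F) -> exists p, F = p%:F.
Proof.
move=> rF; have [p [q [q0 cop eF]]] := ratfun_frac F.
have /size_poly1P [c c0 eq] : size q == 1.
  apply/negPn/negP => /closed_rootP [t rt].
  have [_ [a [b [b0 e _]]]] := rF t.
  have bF0 : b != 0 by apply: contraNneq b0 => ->; rewrite horner0.
  move/eqP: e; rewrite eF eqr_div ?tofrac_eq0 // -!tofracM tofrac_eq.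
  move=> /eqP /(congr1 (fun r : {poly K} => r.[t])).
  rewrite !hornerM (rootP rt) mulr0 => /eqP; rewrite mulf_eq0 (negPf b0) orbF.
  move=> pt; have := coprimep_root cop pt.
  by rewrite (rootP rt) eqxx.
exists (p * c^-1%:P); rewrite eF eq tofracM; congr (_ * _).
by rewrite -/(rconst c) -/(rconst c^-1) fmorphV.
Qed.

Lemma regular_outside F : exists s, forall g, g \notin s -> regular g F.
Proof.
have [p [q [q0 _ eF]]] := ratfun_frac F.
have [s es] := closed_field_poly_normal q.
exists s => g gs; exists (p.[g] / q.[g]), p, q; split=> //.
apply: contraNneq gs => qg; rewrite -root_prod_XsubC.
have : root q g by apply/rootP.
by rewrite es rootZ // lead_coef_eq0.
Qed.

Lemma has_value_pole_term (g h a : K) :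
  has_value h (unif h * pole_term a (Some g)) (if g == h then a else 0).
Proof.
rewrite /= -/(unif g) -/(rconst a); case: eqVneq => [->|gh].
  by rewrite mulrCA (divff (unif_neq0 _)) mulr1; exact: has_value_const.
rewrite mulrA -[0](mul0r (h - g)^-1); apply: has_valueM.
  by rewrite -[0](mul0r a); apply: has_valueM;
    [exact: has_value_unif | exact: has_value_const].
apply: has_valueV; first by rewrite subr_eq0 eq_sym.
by have := has_value_poly h ('X - g%:P); rewrite hornerXsubC.
Qed.

Lemma regular_pole_term (g h a : K) : g != h -> regular h (pole_term a (Some g)).
Proof.
move=> gh; apply: has_value0_unif.
by have := has_value_pole_term g h a; rewrite (negPf gh).
Qed.

Lemma nonconstant_inv : nonconstant ('X%:F : ratfun K)^-1.
Proof. exact/nonconstantV/nonconstantX. Qed.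

(** The change of variable [z -> 1 / z], which exchanges 0 and infinity. *)
Local Notation inf := (csubst nonconstant_inv).

Lemma unif0 : unif 0 = 'X%:F :> ratfun K.
Proof. by rewrite /unif subr0. Qed.

Lemma has_value_pole_term_inf (g a : K) :
  has_value 0 (unif 0 * inf (pole_term a (Some g))) 0.
Proof.
have X0 := unif_neq0 (0 : K).
have -> : unif 0 * inf (pole_term a (Some g)) =
    rconst a * (unif 0 ^+ 2 * (1 - rconst g * unif 0)^-1).
  rewrite /= -/(rconst a) fmorph_div /= csubst_const tofracB.
  rewrite -/(rconst g) rmorphB /=.
  rewrite csubstX csubst_const -unif0.
  have -> : (unif 0)^-1 - rconst g = (unif 0)^-1 * (1 - rconst g * unif 0).
    by rewrite mulrBr mulr1 mulrCA mulVf // mulr1.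
  rewrite invfM invrK expr2 [LHS]mulrCA; congr (_ * _).
  by rewrite mulrA.
rewrite -[X in has_value _ _ X](mulr0 a); apply: has_valueM.
  exact: has_value_const.
rewrite -[X in has_value _ _ X](mul0r (1 - g * 0)^-1); apply: has_valueM.
  by have := has_valueX 2 (has_value_unif (0 : K)); rewrite expr0n.
apply: has_valueV; first by rewrite mulr0 subr0 oner_neq0.
apply: has_valueB.
  rewrite -[X in has_value _ X _](rmorph1 (@rconst K)).
  exact: has_value_const.
by apply: has_valueM; [exact: has_value_const | exact: has_value_unif].
Qed.

(** A function with at most simple poles, the finite ones in [s], is the sum of
    its polar parts and a constant. The residues [v g] may vanish. *)
Lemma partial_fractions F s (v : K -> K) (w : K) : uniq s ->
  (forall g, g \notin s -> regular g F) ->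
  (forall g, has_value g (unif g * F) (v g)) ->
  has_value 0 (unif 0 * inf F) w ->
  exists a0, F = rconst a0 +
    \sum_(x <- None :: map Some s) pole_term (if x is Some g then v g else w) x.
Proof.
move=> us rF hF hw; rewrite big_cons big_map.
set E := \sum_(g <- s) _; set T := pole_term w None.
have eT : T = rconst w * unif 0.
  by rewrite /T /= unif0 -mul_polyC tofracM.
have rT g : regular g T by exists (w *: 'X).[g]; exact: has_value_poly.
have [p ep] : exists p, F - T - E = p%:F.
  apply: regular_everywhere => g; have [gs|gs] := boolP (g \in s).
    apply: has_value0_unif; rewrite mulrBr mulrBr.
    rewrite -[X in has_value _ _ X](subrr (v g)); apply: has_valueB.
      rewrite -[v g]subr0; apply: has_valueB => //.
      have := has_valueM (has_value_unif g) (has_value_poly g (w *: 'X)).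
      by rewrite mul0r.
    have -> : v g = \sum_(h <- s) (if h == g then v h else 0).
      rewrite (bigD1_seq g) //= eqxx big1 ?addr0 // => h hg.
      by rewrite (negPf hg).
    rewrite mulr_sumr.
    by apply: has_value_sum => h _ _; exact: has_value_pole_term.
  have rE : regular g E.
    rewrite /E big_seq; apply: (big_ind (regular g)) => [||h hs].
    - by exists 0; exact: has_value0.
    - by move=> *; exact: regularD.
    - by apply: regular_pole_term; apply: contraNneq gs => <-.
  by apply: regularB => //; apply: regularB => //; exact: rF.
have hp : has_value 0 (unif 0 * inf p%:F) 0.
  rewrite -ep !rmorphB !mulrBr -[X in has_value _ _ X](subr0 0).
  apply: has_valueB.
    rewrite -[X in has_value _ _ X](subrr w); apply: has_valueB => //.
    rewrite eT rmorphM /= csubst_const unif0 csubstX mulrCA -unif0.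
    by rewrite (divff (unif_neq0 _)) mulr1; exact: has_value_const.
  rewrite rmorph_sum mulr_sumr.
  rewrite -[X in has_value _ _ X](big1_eq (op := +%R) s xpredT).
  by apply: has_value_sum => h _ _; exact: has_value_pole_term_inf.
suff /size1_polyC ep0 : (size p <= 1)%N.
  exists p`_0; have -> : rconst p`_0 = F - (T + E).
    by rewrite opprD addrA ep {2}ep0.
  by rewrite subrK.
(* A nonconstant [p] would have a pole at infinity. *)
rewrite leqNgt; apply/negP; case sp: (size p) => [|[|n]] // _.
have : has_value 0 (unif 0 ^+ n.+1 * inf p%:F) (lead_coef p * 1 ^+ n.+1).
  rewrite /csubst rcomp_poly; last exact: nonconstant_inv.
  apply: has_value_homogeneous => //; first exact: has_value_unif.
  rewrite unif0 divff -?unif0 ?unif_neq0 //.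
  rewrite -[X in has_value _ X _](rmorph1 (@rconst K)).
  exact: has_value_const.
rewrite exprSr -mulrA expr1n mulr1 => hl.
have := has_value_uniq hl (has_valueM (has_valueX n (has_value_unif 0)) hp).
by rewrite mulr0 => /eqP; rewrite lead_coef_eq0 -size_poly_eq0 sp.
Qed.

End PartialFractions.

(** * Polynomial identities between rational functions *)

Section Main.
Variable K : closedFieldType.
Local Notation inf := (csubst (@nonconstant_inv K)).

(** The theorem for functions that generate the field of rational functions:
    no right factor is needed. *)
Lemma common_simple_poles (A B : {poly K}) (n : nat) (C D : ratfun K) :
  size A = n.+1 -> size B = n.+1 -> n%:R != 0 :> K ->
  psubst A C = psubst B D -> subfield_gen C^-1 (C^-1 * D) 'X%:F ->
  exists (r : nat) (gamma : 'I_r -> option K) (alpha0 beta0 : K)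
      (alpha beta : 'I_r -> K),
    [/\ injective gamma,
        C = simple_pole_fun gamma alpha0 alpha,
        D = simple_pole_fun gamma beta0 beta
      & forall i : 'I_r,
          lead_coef A * alpha i ^+ n = lead_coef B * beta i ^+ n].
Proof.
move=> sA sB nK eAB gX.
have /choice [vC hC] : forall g, exists c, has_value g (unif g * C) c.
  by move=> g; have [[c hc] _] := simple_poles g sA sB nK eAB gX; exists c.
have /choice [vD hD] : forall g, exists c, has_value g (unif g * D) c.
  by move=> g; have [_ [c hc]] := simple_poles g sA sB nK eAB gX; exists c.
have eABi : psubst A (inf C) = psubst B (inf D) by rewrite -!csubst_psubst eAB.
have gXi : subfield_gen (inf C)^-1 ((inf C)^-1 * inf D) 'X%:F.
  have := proj2 (subfield_gen_csubst (@nonconstant_inv K) _ _ _) gX.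
  rewrite csubstX rmorphM !fmorphV /= => gV.
  by have := subfieldV (subfield_gen_is_subfield _ _) gV; rewrite invrK.
have [[wC hCi] [wD hDi]] := simple_poles 0 sA sB nK eABi gXi.
have [sC rC] := regular_outside C; have [sD rD] := regular_outside D.
pose s := undup (sC ++ sD); pose l := None :: map Some s.
have us : uniq s := undup_uniq _.
have [|a0 eC] := @partial_fractions _ C s vC wC us _ hC hCi.
  by move=> g; rewrite mem_undup mem_cat negb_or => /andP [gC _]; exact: rC.
have [|b0 eD] := @partial_fractions _ D s vD wD us _ hD hDi.
  by move=> g; rewrite mem_undup mem_cat negb_or => /andP [_ gD]; exact: rD.
(* The list [l] contains infinity and all the poles of [C] and [D]; the
   relation also holds, as [0 = 0], at a point that is not a pole. *)
pose res (v : K -> K) (w : K) x := if x is Some g then v g else w.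
have ul : uniq l.
  rewrite /l cons_uniq map_inj_uniq ?us ?andbT; last by move=> x y [].
  by apply/negP => /mapP [].
have sumE (f : option K -> ratfun K) :
    \sum_(x <- l) f x = \sum_(i < size l) f (nth None l i).
  by rewrite (big_nth None) big_mkord.
exists (size l), (fun i => nth None l i), a0, b0,
  (fun i => res vC wC (nth None l i)), (fun i => res vD wD (nth None l i)).
split.
- move=> i j /eqP; rewrite nth_uniq // => /eqP; exact: val_inj.
- by rewrite [LHS]eC /simple_pole_fun sumE.
- by rewrite [LHS]eD /simple_pole_fun sumE.
- move=> i; case: (nth None l i) => [g|] /=.
    apply: (has_value_uniq (has_value_homogeneous sA (has_value_unif g) (hC g))).
    by rewrite eAB; exact: has_value_homogeneous (has_value_unif g) (hD g).
  apply: (has_value_uniq (has_value_homogeneous sA (has_value_unif 0) hCi)).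
  by rewrite eABi; exact: has_value_homogeneous (has_value_unif 0) hDi.
Qed.

Lemma common_right_factor (A B : {poly K}) (n : nat) (C D : ratfun K) :
  size A = n.+1 -> size B = n.+1 -> n%:R != 0 :> K ->
  nonconstant C -> nonconstant D -> rcomp A%:F C = rcomp B%:F D ->
  exists (W : ratfun K) (r : nat) (gamma : 'I_r -> option K)
      (alpha0 beta0 : K) (alpha beta : 'I_r -> K),
    [/\ nonconstant W,
        injective gamma,
        C = rcomp (simple_pole_fun gamma alpha0 alpha) W,
        D = rcomp (simple_pole_fun gamma beta0 beta) W
      & forall i : 'I_r,
          lead_coef A * alpha i ^+ n = lead_coef B * beta i ^+ n].
Proof.
move=> sA sB nK ncC ncD; rewrite !rcomp_poly // => eAB.
pose L := subfield_gen C^-1 (C^-1 * D).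
have subL : is_subfield L := subfield_gen_is_subfield _ _.
have LC : L C.
  rewrite -[C]invrK; apply: (subfieldV subL).
  by apply: gen_subfield; exact: Gen_fst.
have LD : L D.
  rewrite -(mulVKf (nonconstant_neq0 ncC) D); apply: (subfieldM subL) => //.
  by apply: gen_subfield; exact: Gen_snd.
have [W [ncW LW genW]] := Luroth subL LC ncC.
have [C1 eC] := genW _ LC; have [D1 eD] := genW _ LD.
have {}eC : C = csubst ncW C1 := eC; have {}eD : D = csubst ncW D1 := eD.
have eAB1 : psubst A C1 = psubst B D1.
  by apply: (@csubst_inj _ _ ncW); rewrite !csubst_psubst -eC -eD.
have gX : subfield_gen C1^-1 (C1^-1 * D1) 'X%:F.
  apply/(subfield_gen_csubst ncW).
  by rewrite csubstX rmorphM !fmorphV /= -eC -eD.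
have [r [gamma [a0 [b0 [a [b [inj_gamma eC1 eD1 rel]]]]]]] :=
  common_simple_poles sA sB nK eAB1 gX.
by exists W, r, gamma, a0, b0, a, b; split=> //; rewrite -?eC1 -?eD1.
Qed.

End Main.

Theorem corollary4p4 (R : realType) (n : nat) (A B : {poly R[i]})
    (C D : ratfun R[i])
    (hn : (0 < n)%N) (hA : size A = n.+1) (hB : size B = n.+1)
    (hC : nonconstant C) (hD : nonconstant D)
    (hAB : rcomp A%:F C = rcomp B%:F D) :
  exists (W : ratfun R[i]) (r : nat) (gamma : 'I_r -> option R[i])
      (alpha0 beta0 : R[i]) (alpha beta : 'I_r -> R[i]),
    [/\ nonconstant W,
        injective gamma,
        C = rcomp (simple_pole_fun gamma alpha0 alpha) W,
        D = rcomp (simple_pole_fun gamma beta0 beta) W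
      & forall i : 'I_r,
          lead_coef A * alpha i ^+ n = lead_coef B * beta i ^+ n].
Proof.
apply: common_right_factor => //.
by rewrite pnatr_eq0 -lt0n.
Qed.
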